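(* Let $(T,o)$ be a rooted directed tree on $k\ge1$ vertices, let $H$ be a finite digraph, let $\Delta\ge0$, and let $\boldsymbol\alpha=(\alpha_x)_{x\in V(T)}\in[0,\infty)^{V(T)}$. Then $$\hom_{\Delta,\boldsymbol\alpha}(T,H)\;\le\;4\sum_{v\in V(H)}d(v)^{k-1+|\boldsymbol\alpha|}\,\mathbf 1\{d(v)\ge\Delta\},$$ where $|\boldsymbol\alpha|:=\sum_{x\in V(T)}\alpha_x$. In particular, $$\hom_\Delta(T,H)\le 2\sum_{v\in V(H)}d(v)^{k-1}\,\mathbf 1\{d(v)\ge\Delta\}.$$
   Context: A digraph is a finite directed simple loopless graph: at most one arc for each ordered pair of distinct vertices (opposite arcs are allowed). A rooted directed tree $(T,o)$ is an orientation of a finite undirected tree with a distinguished vertex $o$. $\mathrm{Hom}(T,H)$ is the set of digraph homomorphisms $T\to H$ (maps $V(T)\to V(H)$ sending arcs to arcs, preserving direction). For $v\in V(H)$, $d(v):=\deg_{\mathrm{in}}(v)+\deg_{\mathrm{out}}(v)$ is the total degree in $H$. Define $$\hom_\Delta(T,H):=|\{\varphi\in\mathrm{Hom}(T,H): d(\varphi(o))\ge\Delta\}|,$$ $$\hom_{\Delta,\boldsymbol\alpha}(T,H):=\sum_{\varphi\in\mathrm{Hom}(T,H)}\mathbf 1\{d(\varphi(o))\ge\Delta\}\prod_{x\in V(T)}d(\varphi(x))^{\alpha_x}.$$ Convention: $0^0=1$. *)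

(* Defs.v *)
From HB Require Import structures.
From mathcomp Require Import all_boot all_order all_algebra.
From mathcomp Require Import reals exp.

Set Implicit Arguments.
Unset Strict Implicit.
Unset Printing Implicit Defensive.

Import Order.TTheory GRing.Theory Num.Theory.
Local Open Scope ring_scope.

Record digraph := Digraph {
  vertex :> finType;
  arc : rel vertex;
  arc_irr : irreflexive arc
}.

Definition deg_in (H : digraph) (v : H) : nat := #|[set u : H | arc u v]|.
Definition deg_out (H : digraph) (v : H) : nat := #|[set w : H | arc v w]|.
Definition deg (H : digraph) (v : H) : nat := (deg_in v + deg_out v)%N.

Definition adj (T : digraph) : rel T := [rel x y | arc x y || arc y x].

(* In a symmetric irreflexive graph, a duplicate-free closed sequence of size
   2 is a single edge traversed back and forth; the graph-theoretic cycles are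
   those of size at least 3. *)
Definition acyclic_rel (V : finType) (e : rel V) : Prop :=
  forall c : seq V, ucycle e c -> (size c < 3)%N.

Definition is_tree_rel (V : finType) (e : rel V) : Prop :=
  (forall x y : V, connect e x y) /\ acyclic_rel e.

(* The first clause says that each underlying edge carries only one arc.
   [is_tree_rel] does not exclude the empty graph; a root does. *)
Definition is_directed_tree (T : digraph) : Prop :=
  (forall x y : T, arc x y -> ~~ arc y x) /\ is_tree_rel (@adj T).

Definition Hom (T H : digraph) : {set {ffun T -> H}} :=
  [set f : {ffun T -> H} | [forall x, forall y, arc x y ==> arc (f x) (f y)]].

Definition hom_ge (R : realType) (T : digraph) (o : T) (H : digraph)
    (Delta : R) : nat :=
  #|[set f in Hom T H | Delta <= (deg (f o))%:R]|.

(* [powR] satisfies 0 `^ 0 = 1 and 0 `^ a = 0 for a != 0. *)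
Definition hom_ge_wt (R : realType) (T : digraph) (o : T) (H : digraph)
    (Delta : R) (alpha : T -> R) : R :=
  \sum_(f in Hom T H | Delta <= (deg (f o))%:R)
    \prod_(x : T) (deg (f x))%:R `^ alpha x.

(* Main.v *)
Require Import Defs.
From HB Require Import structures.
From mathcomp Require Import all_boot all_order all_algebra.
From mathcomp Require Import reals sequences exp.

Set Implicit Arguments.
Unset Strict Implicit.
Unset Printing Implicit Defensive.

Import Order.TTheory GRing.Theory Num.Theory.
Local Open Scope ring_scope.

(** The proof reweights homomorphisms. Write [d] for the total degree in [H]
    and [deg_T x] for the number of neighbours of [x] in the underlying tree of
    [T], and give a homomorphism [f] the weight
      [W f = \prod_x d (f x)^(1 - deg_T x)].
    On an undirected host with positive degrees this is the law of the
    tree-indexed simple random walk started from the measure [d], which is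
    stationary, so the law of [f x] is [d] for every vertex [x], whichever
    vertex one regards as the root. For a digraph the same
    computation gives an inequality: deleting a leaf [y] attached to [z] costs
    a sum over at most [d (f z)] values of [f y], which is what the factor
    [1 / d (f z)] lost with the edge pays for. Peeling leaves down to [x] gives
    [\sum_(f | f x = v) W f <= d v] ([anchored_hom_weight],
    [sum_hom_weight]).

    Let the tree have [k >= 2] vertices. Then [deg_T x >= 1], and
    [\prod_x d (f x)^alpha_x = W f * \prod_x d (f x)^(g x)] with exponents
    [g x = alpha_x + deg_T x - 1 >= 0] of sum [G = k - 2 + |alpha|]. The weighted
    arithmetic-geometric inequality ([weighted_amgm]) replaces the product by a
    convex combination of the powers [d (f x)^G]. If [d (f o) >= Delta], then
    either [d (f x) >= Delta] as well, or [d (f x)^G <= d (f o)^G]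
    ([threshold_transfer]); so each term is at most a sum of two terms in which
    the threshold and the power sit at one and the same vertex of [T]. By the
    marginal bound each of these contributes at most
    [\sum_(v | d v >= Delta) d v^(G + 1)], and [G + 1 = k - 1 + |alpha|].
    This proves both inequalities with the constant 2; for [k = 1] the constant
    1 is enough. *)

(* Restores two names that later imports overload, for arcs of cyclic
   sequences and for linear maps. *)
Local Notation arc := Defs.arc.
Local Notation Hom := Defs.Hom.

(** * Growing a tree leaf by leaf *)

Section Grown.
Variables (V : finType) (e : rel V).

(** [grown x S] says that [S] arises from [x] by successive attachment of
    leaves: it turns peeling leaves off a tree, down to any chosen vertex, into
    structural induction. *)
Inductive grown (x : V) : {set V} -> Prop :=
| GrownRoot : grown x [set x]
| GrownLeaf S y z : grown x S -> y \notin S -> z \in S ->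
    {in S, forall t, e t y = (t == z)} -> grown x (y |: S).

Lemma grown_root x S : grown x S -> x \in S.
Proof.
elim=> [|{}S y z _ xS _ _ _]; first by rewrite set11.
by rewrite in_setU1 xS orbT.
Qed.

Hypothesis e_sym : symmetric e.

Lemma grown_path x S : grown x S -> {in S &, forall a b,
  exists p, [/\ path e a p, last a p = b & {subset p <= S}]}.
Proof.
elim=> [|{}S y z _ IH yS zS ez] a b.
  by move=> /set1P-> /set1P->; exists [::].
have eyz : e z y by rewrite ez.
have sub (p : seq V) : {subset p <= S} -> {subset p <= y |: S}.
  by move=> pS t /pS tS; rewrite in_setU1 tS orbT.
case/setU1P=> [->|aS] /setU1P[->|bS].
- by exists [::].
- have [p [ep lp pS]] := IH _ _ zS bS.
  exists (z :: p); split=> //=; first by rewrite e_sym eyz.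
  by apply: sub => t; rewrite inE => /orP[/eqP->|/pS].
- have [p [ep lp pS]] := IH _ _ aS zS.
  exists (rcons p y); split; rewrite ?last_rcons ?rcons_path ?ep ?lp //.
  move=> t; rewrite mem_rcons inE => /orP[/eqP->|]; first exact: setU11.
  exact: sub.
- have [p [ep lp pS]] := IH _ _ aS bS.
  by exists p; split=> //; apply: sub.
Qed.

(** Two distinct neighbours of [y] in [S] would be joined by a path in [S], and
    [y] would close it into a cycle. *)
Lemma acyclic_unique_nbr x S y z t : acyclic_rel e -> grown x S ->
  y \notin S -> z \in S -> t \in S -> e z y -> e t y -> t = z.
Proof.
move=> acyc gS yS zS tS ezy ety.
have [p [ep lp pS]] := grown_path gS tS zS.
(* If [t] and [z] differ then [p'] is nonempty, and the cycle below has size at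
   least 3. *)
case/shortenP: ep lp => p' ep' up' sp' lp'.
have : ucycle e (y :: t :: p').
  rewrite /ucycle /= rcons_path lp' ep' ezy e_sym ety /= -/(uniq (t :: p')) up'.
  rewrite andbT; apply: contra yS; rewrite inE => /orP[/eqP->//|/sp'/pS//].
by move=> /acyc; case: p' lp' {ep' up' sp'}.
Qed.

Lemma connected_crossing x (S : {set V}) : (forall a b, connect e a b) ->
  x \in S -> S != setT -> exists z y, [/\ z \in S, y \notin S & e z y].
Proof.
move=> conn xS nT.
have [/existsP[z /existsP[y /and3P[]]]|none] :=
  boolP [exists z, exists y, [&& z \in S, y \notin S & e z y]].
  by exists z, y.
case/negP: nT; apply/eqP/setP => b; rewrite inE.
case/connectP: (conn x b) => p ep ->.
elim: p x xS ep => //= a p IH x xS /andP[exa]; apply: IH.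
move: none; rewrite negb_exists => /forallP/(_ x).
rewrite negb_exists => /forallP/(_ a); rewrite xS exa andbT /=.
by rewrite negbK.
Qed.

Lemma tree_grown x : is_tree_rel e -> grown x setT.
Proof.
move=> [conn acyc].
suff ext n S : (#|~: S| <= n)%N -> grown x S -> grown x setT.
  exact: ext (leqnn _) (GrownRoot x).
elim: n S => [|n IH] S cS gS; have [<-//|nT] := eqVneq S setT;
  have [z [y [zS yS ezy]]] := connected_crossing conn (grown_root gS) nT.
  by move: cS; rewrite (cardsD1 y) inE yS.
apply: (IH (y |: S)).
  by move: cS; rewrite (cardsD1 y) inE yS add1n ltnS setCU setIC -setDE.
apply: (GrownLeaf gS yS zS) => t tS; apply/idP/eqP => [ety|->//].
exact: (acyclic_unique_nbr acyc gS yS zS tS ezy ety).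
Qed.

Definition nbr_card (S : {set V}) t := #|[set z in S | e t z]|.

Hypothesis e_irr : irreflexive e.

Lemma nbr_card_root x : nbr_card [set x] x = 0%N.
Proof.
apply: eq_card0 => t; rewrite !inE.
by case: eqP => // ->; rewrite e_irr.
Qed.

Lemma nbr_card_leaf (S : {set V}) y z : z \in S ->
  {in S, forall t, e t y = (t == z)} -> nbr_card (y |: S) y = 1%N.
Proof.
move=> zS ez; apply/eqP/cards1P; exists z; apply/setP => t.
rewrite !inE; have [->|_] /= := eqVneq t y.
  by rewrite e_irr; apply/esym/eqP => yz; move: (ez _ zS); rewrite -yz e_irr eqxx.
have [tS|tS] := boolP (t \in S); first by rewrite e_sym ez.
by apply/esym; apply: contraNF tS => /eqP->.
Qed.

Lemma nbr_card_add (S : {set V}) y z t : y \notin S -> t \in S ->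
  {in S, forall t, e t y = (t == z)} ->
  nbr_card (y |: S) t = (nbr_card S t + (t == z))%N.
Proof.
move=> yS tS ez; rewrite /nbr_card (cardsD1 y) !inE eqxx /= ez // addnC.
congr (_ + _)%N; apply: eq_card => u; rewrite !inE.
by have [->|] := eqVneq u y; rewrite ?(negbTE yS).
Qed.

(** The handshake count: a grown set of [n] vertices has [n - 1] edges. The
    form with [+ 2] avoids truncated subtraction. *)
Lemma sum_nbr_card x S : grown x S ->
  ((\sum_(t in S) nbr_card S t) + 2 = 2 * #|S|)%N.
Proof.
elim=> [|{}S y z _ IH yS zS ez].
  by rewrite big_set1 cards1 nbr_card_root.
rewrite big_setU1 //= (nbr_card_leaf zS ez) cardsU1 yS mulnDr -IH.
under eq_bigr => t tS do rewrite (nbr_card_add yS tS ez).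
have -> : (\sum_(t in S) (nbr_card S t + (t == z)) =
    \sum_(t in S) nbr_card S t + 1)%N.
  rewrite big_split /=.
  by congr (_ + _)%N; rewrite (bigD1 z) //= eqxx big1 // => t /andP[_ /negbTE->].
by rewrite addnCA -addnA [RHS]addnCA.
Qed.

Lemma nbr_card_gt0 t : (1 < #|V|)%N -> (forall a b, connect e a b) ->
  (0 < nbr_card setT t)%N.
Proof.
move=> V1 conn; have nT : [set t] != setT.
  by apply/eqP => tT; move: V1; rewrite -cardsT -tT cards1.
have [z [y [/set1P-> _ ety]]] := connected_crossing conn (set11 t) nT.
by apply/card_gt0P; exists y; rewrite !inE.
Qed.

End Grown.

(** * One-vertex marginals of the reweighted homomorphisms *)

Section Marginal.
Variables (R : realType) (T H : digraph).
Implicit Types (S : {set T}) (f g : {ffun T -> H}).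
Notation tdeg := (nbr_card (@adj T)).

Lemma adj_sym : symmetric (@adj T).
Proof. by move=> a b; rewrite /adj /= orbC. Qed.

Lemma adj_irr : irreflexive (@adj T).
Proof. by move=> a; rewrite /adj /= arc_irr. Qed.

Definition hom_on S f :=
  [forall a in S, forall b in S, arc a b ==> arc (f a) (f b)].

(** The weight [W] restricted to [S]: the exponent [1 - deg_S t] is split into a
    factor and a power of an inverse, since it may be negative. Only neighbours
    inside [S] count, so that deleting a leaf changes the exponent of its
    neighbour by one. *)
Definition tree_weight S f : R :=
  \prod_(t in S) ((deg (f t))%:R * (deg (f t))%:R ^- tdeg S t).

(** Maps defined on [S] and sending [x] to [v] are encoded as maps on all of [T]
    that take the value [v] at [x] and off [S]. *)
Definition anchored x (v : H) S f := [forall t, (t \notin S :\ x) ==> (f t == v)].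

(** With the default value [v], this is restriction from [y |: S] to [S] in the
    encoding of [anchored]. *)
Definition reset y (v : H) f : {ffun T -> H} :=
  [ffun t => if t == y then v else f t].

Lemma tree_weight_ge0 S f : 0 <= tree_weight S f.
Proof. by apply: prodr_ge0 => t _; rewrite mulr_ge0 ?invr_ge0 ?exprn_ge0. Qed.

Lemma divff_le1 (a : R) : a / a <= 1.
Proof. by have [->|a0] := eqVneq a 0; rewrite ?mul0r ?divff. Qed.

(** A leaf [y] carries the factor [d / d <= 1] (it vanishes in degree 0), while
    its neighbour [z] gains an edge and so the factor [1 / d (f z)]. *)
Lemma tree_weight_leaf S y z f v : y \notin S -> z \in S ->
  {in S, forall t, adj t y = (t == z)} ->
  tree_weight (y |: S) f
    <= tree_weight S (reset y v f) / (deg (f z))%:R.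
Proof.
move=> yS zS ez; rewrite {1}/tree_weight big_setU1 //=.
rewrite (nbr_card_leaf adj_sym adj_irr zS ez) expr1.
have -> : \prod_(t in S) ((deg (f t))%:R * (deg (f t))%:R ^- tdeg (y |: S) t)
  = tree_weight S (reset y v f) / (deg (f z))%:R :> R.
  rewrite /tree_weight [LHS](bigD1 z) //= [in RHS](bigD1 z) //=.
  have rs t : t \in S -> reset y v f t = f t.
    by move=> tS; rewrite ffunE; case: eqP tS yS => // -> ->.
  rewrite (nbr_card_add yS zS ez) eqxx addn1 rs // exprS invfM.
  rewrite -!mulrA; congr (_ * _); rewrite [LHS]mulrC -mulrA.
  congr (_ * (_ * _)); apply: eq_bigr => t /andP[tS tz].
  by rewrite (nbr_card_add yS tS ez) (negbTE tz) addn0 rs.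
apply: ler_piMl; last exact: divff_le1.
by rewrite mulr_ge0 ?invr_ge0 ?tree_weight_ge0.
Qed.

(** An extension to the leaf [y] is determined by the image of [y], an in- or
    out-neighbour of [g z] according to the direction of the arc. *)
Lemma card_leaf_extensions S y z v g : y \notin S -> z \in S -> adj z y ->
  (#|[set f | hom_on (y |: S) f & reset y v f == g]| <= deg (g z))%N.
Proof.
move=> yS zS; set F := [set f | _ & _] => ezy.
have injF : {in F &, injective (fun f : {ffun T -> H} => f y)}.
  move=> f1 f2; rewrite !inE => /andP[_ /eqP<-] /andP[_ /eqP/ffunP E] Ey.
  apply/ffunP => t; have := E t; rewrite !ffunE.
  by have [->|] := eqVneq t y.
have Fz f : f \in F -> f z = g z /\
    (forall a b, a \in y |: S -> b \in y |: S -> arc a b -> arc (f a) (f b)).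
  rewrite inE => /andP[/forall_inP hf /eqP<-]; split.
    by rewrite ffunE; case: eqP yS => // <-; rewrite zS.
  by move=> a b aS bS; apply/implyP/(forall_inP (hf _ aS)).
have zS' : z \in y |: S by rewrite in_setU1 zS orbT.
have yS' : y \in y |: S := setU11 _ _.
rewrite -(card_in_imset injF) /deg; case/orP: ezy => [azy|ayz].
  apply: leq_trans (leq_addl _ _); apply: subset_leq_card.
  apply/subsetP => _ /imsetP[f /Fz[<- hf] ->]; rewrite inE.
  exact: hf azy.
apply: leq_trans (leq_addr _ _); apply: subset_leq_card.
apply/subsetP => _ /imsetP[f /Fz[<- hf] ->]; rewrite inE.
exact: hf ayz.
Qed.

(** The marginal of the weight at [x] is at most the degree. Removing a leaf
    [y] attached to [z], the factor [1 / d (g z)] compensates for the at most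
    [d (g z)] extensions of [g] to [y]; when only [x] is left the weight is the
    degree itself. *)
Lemma anchored_hom_weight x v S : grown (@adj T) x S ->
  \sum_(f | anchored x v S f && hom_on S f) tree_weight S f <= (deg v)%:R.
Proof.
elim=> [|{}S y z gS IH yS zS ez].
  apply: (@le_trans _ _ (\sum_(f | f == [ffun=> v]) tree_weight [set x] f)).
    rewrite [leLHS]big_mkcond [leRHS]big_mkcond; apply: ler_sum => f _.
    case: andP => [[/forallP fv _]|_]; last by case: ifP; rewrite ?tree_weight_ge0.
    suff -> : f == [ffun=> v] by [].
    apply/eqP/ffunP => t; rewrite ffunE; have := fv t.
    by rewrite !inE andNb => /eqP.
  rewrite big_pred1_eq /tree_weight big_set1 ffunE.
  by rewrite (nbr_card_root adj_irr) expr0 invr1 mulr1.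
(* Group the maps on [y |: S] by their restriction [g] to [S]. *)
apply: le_trans IH; rewrite (partition_big (reset y v)
  (fun g => anchored x v S g && hom_on S g)) /=; last first.
  move=> f /andP[/forallP fv /forall_inP hf]; apply/andP; split.
    apply/forallP => t; apply/implyP => tS; rewrite ffunE.
    have [//|ty] := eqVneq t y; have := fv t.
    by rewrite in_setD1 in_setU1 (negbTE ty) /= -in_setD1 tS.
  apply/forall_inP => a aS; apply/forall_inP => b bS; apply/implyP => ab.
  have ny t : t \in S -> (t == y) = false.
    by move=> tS; apply: contraNF yS => /eqP<-.
  have SU t : t \in S -> t \in y |: S by move=> tS; rewrite in_setU1 tS orbT.
  rewrite !ffunE !ny //.
  by have /forall_inP/(_ _ (SU _ bS))/implyP := hf _ (SU _ aS); apply.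
apply: ler_sum => g _.
apply: (@le_trans _ _ (\sum_(f in [set f | hom_on (y |: S) f & reset y v f == g])
    tree_weight S g / (deg (g z))%:R)).
  rewrite [leLHS]big_mkcond [leRHS]big_mkcond; apply: ler_sum => f _.
  have w0 : 0 <= tree_weight S g / (deg (g z))%:R.
    by rewrite mulr_ge0 ?invr_ge0 ?tree_weight_ge0.
  rewrite inE -andbA; case: (anchored _ _ _ _) => /=; last by case: ifP.
  case: andP => // -[_ /eqP rg]; have -> : g z = f z.
    by rewrite -rg ffunE; case: eqP yS => // <-; rewrite zS.
  by rewrite -rg; exact: tree_weight_leaf yS zS ez.
have ezy : adj z y by rewrite ez.
have le_deg := card_leaf_extensions v g yS zS ezy.
rewrite sumr_const -[leLHS]mulr_natl mulrCA ler_piMr ?tree_weight_ge0 //.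
apply: le_trans (divff_le1 (deg (g z))%:R).
by rewrite ler_wpM2r ?invr_ge0 ?ler_nat.
Qed.

(** The tree can be grown from any of its vertices, so the marginal bound is
    available at every [x]. *)
Lemma sum_hom_weight x (P : pred H) (F : H -> R) : is_tree_rel (@adj T) ->
  (forall v, 0 <= F v) ->
  \sum_(f in Hom T H | P (f x)) tree_weight setT f * F (f x)
    <= \sum_(v | P v) (deg v)%:R * F v.
Proof.
move=> treeT F0.
rewrite (partition_big (fun f : {ffun T -> H} => f x) P) /=; last by move=> f /andP[].
apply: ler_sum => v _.
apply: (@le_trans _ _ (\sum_(f | anchored x v setT f && hom_on setT f)
    tree_weight setT f * F v)).
  rewrite [leLHS]big_mkcond [leRHS]big_mkcond; apply: ler_sum => f _.
  have w0 : 0 <= tree_weight setT f * F v.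
    by rewrite mulr_ge0 ?tree_weight_ge0.
  case: ifP => [/andP[/andP[hf _] /eqP fx]|_]; last by case: ifP.
  rewrite ifT ?fx //; apply/andP; split.
    apply/forallP => t; rewrite !inE andbT negbK.
    by apply/implyP => /eqP->; rewrite fx.
  move: hf; rewrite inE => /forallP hf; apply/forall_inP => a _.
  by apply/forall_inP => b _; have /forallP := hf a; apply.
rewrite -mulr_suml ler_wpM2r //.
exact: anchored_hom_weight (tree_grown adj_sym x treeT).
Qed.

End Marginal.

(** * The weighted arithmetic-geometric inequality *)

Section WeightedAMGM.
Variables (R : realType) (I : finType).

Lemma prod_powRE (d : I -> R) (g : I -> R) : (forall i, 0 < d i) ->
  \prod_i d i `^ g i = expR (\sum_i g i * ln (d i)).
Proof.
by move=> d0; rewrite expR_sum; apply: eq_bigr => i _; rewrite /powR gt_eqF.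
Qed.

(** The coefficients are [g i / G]. They are hidden behind an existential so that
    the case [G = 0], where the point mass at [i0] serves, needs no separate
    treatment later; what matters is that they do not depend on [d]. *)
Lemma weighted_amgm (i0 : I) (g : I -> R) : (forall i, 0 <= g i) ->
  exists c : I -> R, [/\ forall i, 0 <= c i, \sum_i c i = 1 &
    forall d : I -> R, (forall i, 0 < d i) ->
      \prod_i d i `^ g i <= \sum_i c i * d i `^ (\sum_j g j)].
Proof.
move=> g0; set G := \sum_j g j.
have G0 : 0 <= G by apply: sumr_ge0.
have [GE|Gn] := eqVneq G 0.
  exists (fun i => (i == i0)%:R); split=> [i||d d0]; first exact: ler0n.
    by rewrite (bigD1 i0) //= eqxx big1 ?addr0 // => i /negbTE->.
  rewrite (bigD1 i0) //= [leRHS](bigD1 i0) //= eqxx GE.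
  have gE i : g i = 0.
    move/eqP: GE; rewrite psumr_eq0 // => /allP/(_ i).
    by rewrite mem_index_enum => /(_ isT)/eqP.
  rewrite gE mul1r powRr0 big1 ?mulr1 ?lerDl => [|i _]; last first.
    by rewrite gE powRr0.
  by apply: sumr_ge0 => i _; rewrite mulr_ge0 ?ler0n ?powR_ge0.
have Gp : 0 < G by rewrite lt_def Gn.
exists (fun i => g i / G); split=> [i||d d0].
- by rewrite divr_ge0.
- by rewrite -mulr_suml divff.
set L := \sum_i g i * ln (d i).
rewrite prod_powRE // -/L.
(* Dividing by the geometric mean [expR L], each term is the exponential of
   [G * ln (d i) - L]; these numbers have weighted mean 0, so it suffices to
   sum the tangent bound [1 + u <= expR u]. *)
have step i : g i / G * (1 + (G * ln (d i) - L)) * expR L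
    <= g i / G * d i `^ G.
  rewrite -mulrA ler_wpM2l ?divr_ge0 // /powR gt_eqF //.
  rewrite -[X in _ <= expR X](subrK L) expRD ler_wpM2r ?expR_ge0 //.
  exact: expR_ge1Dx.
apply: le_trans (ler_sum _ (fun i _ => step i)).
rewrite -mulr_suml.
under eq_bigr => i _.
  rewrite mulrDr mulr1 mulrBr mulrA divfK //.
  over.
rewrite big_split /= sumrB -!mulr_suml divff // mul1r -/L subrr addr0.
by rewrite mul1r.
Qed.

End WeightedAMGM.

(** * The degree bound *)

Section Main.
Variables (R : realType) (T H : digraph) (o : T) (Delta : R) (alpha : T -> R).
Hypothesis treeT : is_tree_rel (@adj T).
Hypothesis Delta0 : 0 <= Delta.
Hypothesis alpha0 : forall x, 0 <= alpha x.
Notation tdeg := (nbr_card (@adj T) setT).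
Notation D v := ((deg v)%:R : R).
Notation A := (\sum_x alpha x).

(** An edge of [T] at [x] is sent to an arc at [f x]. *)
Lemma hom_deg_gt0 (f : {ffun T -> H}) x : f \in Hom T H ->
  (0 < tdeg x)%N -> 0 < D (f x).
Proof.
rewrite inE => /forallP hf /card_gt0P[y]; rewrite !inE /= => exy.
rewrite ltr0n addn_gt0; case/orP: exy => a; apply/orP; [right|left];
  apply/card_gt0P; exists (f y); rewrite inE.
  by have /forallP/(_ y)/implyP := hf x; apply.
by have /forallP/(_ x)/implyP := hf y; apply.
Qed.

(** With [a] the degree of [f x] and [b] that of the image of the root: a power
    of [a] that misses the threshold is dominated by that of [b], which meets
    it. *)
Lemma threshold_transfer (a b G : R) : 0 <= a -> 0 <= G ->
  Delta <= b ->
  a `^ G <= (if Delta <= a then a `^ G else 0) + b `^ G.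
Proof.
move=> a0 G0 hb; have b0 : 0 <= b := le_trans Delta0 hb.
case: (leP Delta a) => [_|ha]; first by rewrite lerDl powR_ge0.
rewrite add0r ge0_ler_powR ?nnegrE //; apply: le_trans hb; exact: ltW.
Qed.

(** The bound when [T] has an edge, which makes all the exponents [g x] below
    nonnegative and all the degrees that occur positive. *)
Lemma hom_ge_wt_le_card_gt1 : (1 < #|T|)%N ->
  hom_ge_wt o H Delta alpha
    <= 2 * \sum_(v : H | Delta <= D v) D v `^ ((#|T| - 1)%:R + A).
Proof.
move=> T1; have [conn _] := treeT.
have tdeg0 x : (0 < tdeg x)%N := nbr_card_gt0 x T1 conn.
pose g x := alpha x + (tdeg x - 1)%:R.
have g0 x : 0 <= g x by rewrite addr_ge0.
set G := \sum_x g x.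
have G0 : 0 <= G by apply: sumr_ge0.
have GE : G + 1 = (#|T| - 1)%:R + A.
  rewrite /G big_split /= -addrA addrC; congr (_ + _).
  rewrite -natr_sum natr1; congr _%:R.
  have E1 : (\sum_x tdeg x + 2 = 2 * #|T|)%N.
    have := tree_grown (@adj_sym T) o treeT.
    move=> /(sum_nbr_card (@adj_sym T) (@adj_irr T)); rewrite cardsT => <-.
    by congr (_ + _)%N; apply: eq_bigl => x; rewrite inE.
  have E2 : (\sum_x (tdeg x - 1) + #|T| = \sum_x tdeg x)%N.
    rewrite -sum1_card -big_split /=; apply: eq_bigr => x _; exact: subnK.
  move: T1 E1; rewrite -E2; case: #|T| => // n _; rewrite subn1 /=.
  rewrite addnAC mul2n -addnn => /addIn.
  by rewrite addn2 => -[].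
have [c [c0 c1 amgm]] := weighted_amgm o g0.
pose W f : R := @tree_weight R T H setT f.
have wt f : f \in Hom T H -> \prod_x D (f x) `^ alpha x
    = W f * \prod_x D (f x) `^ g x.
  move=> hf; have -> : W f = \prod_x (D (f x) * D (f x) ^- tdeg x).
    by apply: eq_bigl => x; rewrite inE.
  rewrite -big_split /=; apply: eq_bigr => x _.
  have d0 := hom_deg_gt0 hf (tdeg0 x).
  rewrite /g powRD; last by rewrite (gt_eqF d0) implybT.
  rewrite powR_mulrn // mulrCA mulrAC -exprS.
  by rewrite subn1 prednK // divff ?mulr1 // expf_neq0 // gt_eqF.
pose B := \sum_(v : H | Delta <= D v) D v * D v `^ G.
have sumB x : \sum_(f in Hom T H | Delta <= D (f x)) W f * D (f x) `^ G <= B.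
  apply: (@sum_hom_weight R T H x (fun v => Delta <= D v) (fun v => D v `^ G)) => //.
  by move=> v; apply: powR_ge0.
have -> : \sum_(v : H | Delta <= D v) D v `^ ((#|T| - 1)%:R + A) = B.
  apply: eq_bigr => v _; rewrite -GE addrC powRD ?powRr1 //.
  by rewrite gt_eqF // ltr_wpDr.
apply: (@le_trans _ _ (\sum_x c x * (B + B))); last first.
  by rewrite -mulr_suml c1 mul1r -mulr2n mulr_natl.
(* First the convex combination, with the threshold still at the root. *)
apply: (@le_trans _ _ (\sum_x c x *
   \sum_(f in Hom T H | Delta <= D (f o)) W f * D (f x) `^ G)).
  under [leRHS]eq_bigr => x _ do rewrite mulr_sumr.
  rewrite exchange_big /=; apply: ler_sum => f /andP[hf _].
  rewrite wt //.
  under [leRHS]eq_bigr => x _ do rewrite mulrCA.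
  rewrite -mulr_sumr ler_wpM2l ?tree_weight_ge0 //.
  by apply: amgm => x; apply: hom_deg_gt0.
apply: ler_sum => x _; rewrite ler_wpM2l //.
apply: le_trans (lerD (sumB x) (sumB o)).
(* Then, for a fixed [x], the threshold moves to the vertex bearing the power. *)
have -> : \sum_(f in Hom T H | Delta <= D (f x)) W f * D (f x) `^ G =
    \sum_(f in Hom T H) if Delta <= D (f x) then W f * D (f x) `^ G else 0.
  exact: big_mkcondr.
apply: (@le_trans _ _ (\sum_(f in Hom T H | Delta <= D (f o))
    ((if Delta <= D (f x) then W f * D (f x) `^ G else 0)
     + W f * D (f o) `^ G))).
  apply: ler_sum => f /andP[_ ho].
  rewrite -[0](mulr0 (W f)) -(fun_if (fun u => W f * u)) -mulrDr.
  by rewrite ler_wpM2l ?tree_weight_ge0 ?threshold_transfer.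
rewrite big_split /= lerD2r [leLHS]big_mkcondr /=; apply: ler_sum => f _.
have w0 : 0 <= W f * D (f x) `^ G by rewrite mulr_ge0 ?tree_weight_ge0 ?powR_ge0.
by case: ifP => //; case: ifP.
Qed.

(** The weight argument breaks down here, as the exponent [alpha o - 1] may be
    negative; but a map from one point is determined by its value. *)
Lemma hom_ge_wt_single : #|T| = 1%N ->
  hom_ge_wt o H Delta alpha <= \sum_(v : H | Delta <= D v) D v `^ A.
Proof.
move=> T1; have To x : x = o by have [t tE] := fintype1 T1; rewrite (tE x) (tE o).
rewrite /hom_ge_wt (partition_big (fun f : {ffun T -> H} => f o)
  (fun v => Delta <= D v)) /=; last by move=> f /andP[].
apply: ler_sum => v _.
apply: (@le_trans _ _ (\sum_(f : {ffun T -> H} | f == [ffun=> v]) D v `^ A)).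
  rewrite [leLHS]big_mkcond [leRHS]big_mkcond; apply: ler_sum => f _.
  case: ifP => [/andP[_ /eqP fo]|_]; last by case: ifP; rewrite ?powR_ge0.
  rewrite ifT; last by apply/eqP/ffunP => t; rewrite ffunE (To t).
  rewrite (bigD1 o) //= [\sum_x _](bigD1 o) //= fo.
  by rewrite !big_pred0 ?mulr1 ?addr0 // => t; rewrite (To t) eqxx.
by rewrite big_pred1_eq.
Qed.

End Main.

Lemma hom_ge_wt_le_double (R : realType) (T : digraph) (o : T)
    (hT : is_directed_tree T) (H : digraph) (Delta : R) (hDelta : 0 <= Delta)
    (alpha : T -> R) (halpha : forall x : T, 0 <= alpha x) :
  hom_ge_wt o H Delta alpha
    <= 2 * \sum_(v : H | Delta <= (deg v)%:R)
             (deg v)%:R `^ ((#|T| - 1)%:R + \sum_(x : T) alpha x).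
Proof.
have [T1|T1] := ltnP 1 #|T|; first exact: hom_ge_wt_le_card_gt1 hT.2 hDelta halpha T1.
have TE : #|T| = 1%N.
  by apply/eqP; rewrite eqn_leq T1; apply/card_gt0P; exists o.
apply: (le_trans (hom_ge_wt_single H o Delta alpha TE)).
rewrite TE subnn add0r ler_peMl ?ler1n //.
by apply: sumr_ge0 => v _; apply: powR_ge0.
Qed.

Theorem theorem4p1 (R : realType) (k : nat) (hk : (1 <= k)%N)
    (T : digraph) (o : T) (hT : is_directed_tree T) (hTk : #|T| = k)
    (H : digraph) (Delta : R) (hDelta : 0 <= Delta)
    (alpha : T -> R) (halpha : forall x : T, 0 <= alpha x) :
  hom_ge_wt o H Delta alpha
    <= 4 * \sum_(v : H | Delta <= (deg v)%:R)
             (deg v)%:R `^ ((k - 1)%:R + \sum_(x : T) alpha x)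
  /\
  (hom_ge o H Delta
    <= 2 * \sum_(v : H | (Delta <= (deg v)%:R)%R) deg v ^ (k - 1))%N.
Proof.
split.
  have := hom_ge_wt_le_double o hT H hDelta halpha; rewrite hTk => le2.
  apply: (le_trans le2); rewrite ler_wpM2r ?ler_nat //.
  by apply: sumr_ge0 => v _; apply: powR_ge0.
(* Unweighted counting is the case [alpha = 0], all factors being 1. *)
have := hom_ge_wt_le_double o hT H hDelta (fun _ => lexx 0).
rewrite hTk [X in _ + X]big1 // addr0 => le2.
rewrite -(ler_nat R) natrM natr_sum.
under eq_bigr => v _ do rewrite natrX -powR_mulrn //.
apply: le_trans le2; rewrite le_eqVlt; apply/orP; left; apply/eqP.
rewrite /hom_ge -sum1_card natr_sum /hom_ge_wt.
apply: eq_big => [f|f _]; first by rewrite !inE.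
by rewrite big1 // => x _; rewrite powRr0.
Qed.
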